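(* Let $\langle \Omega,S,V,\pi\rangle$ be a monotone system possessing a top configuration (a greatest element of $\Omega$). Let $\mu$ be the distribution on $\Omega$ which results from successive updates at sites $v_1,\dots,v_m \in V$ (in this order), beginning at the top configuration. Let $\nu$ be defined similarly but with updates only at a subsequence $v_{i_1},\dots,v_{i_k}$ (where $1\le i_1<\dots<i_k\le m$). Then $\mu \preceq \nu$, and $\|\mu-\pi\| \le \|\nu-\pi\|$. Moreover, this also holds if the sequence $v_1,\dots,v_m$ and the indices $i_1,\dots,i_k$ of its subsequence are chosen at random according to any prescribed joint distribution, in which case $\mu$ and $\nu$ denote the averages, over this random choice, of the distributions resulting from the corresponding update sequences.
   Context: A system $\langle \Omega,S,V,\pi\rangle$ consists of a finite set $S$ of spins, a finite set $V$ of sites, a set $\Omega\subseteq S^V$ of configurations, and a probability distribution $\pi$ on $\Omega$ with $\pi(\omega)>0$ for all $\omega\in\Omega$; $\pi$ (and any other distribution on $\Omega$) is extended by $0$ to $S^V\setminus\Omega$. For $\sigma\in\Omega$, $v\in V$, $s\in S$, $\sigma_v^s$ is the configuration with $\sigma_v^s(v)=s$ and $\sigma_v^s(u)=\sigma(u)$ for $u\ne v$, and $\sigma_v^\bullet=\{\sigma_v^s: s\in S\}\cap\Omega$. The update at $v$ of a distribution $\mu$ on $\Omega$ is the distribution $\mu_v(\sigma)=\frac{\pi(\sigma)}{\pi(\sigma_v^\bullet)}\,\mu(\sigma_v^\bullet)$, $\sigma\in\Omega$. Beginning at a configuration means starting from the point mass at it. For distributions on a finite poset $\Gamma$, $\nu\preceq\mu$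 ($\mu$ stochastically dominates $\nu$) means $\int g\,d\nu\le\int g\,d\mu$ for all increasing (i.e. weakly increasing) $g:\Gamma\to\mathbb{R}$. The system is monotone if $S$ is totally ordered, $S^V$ has the coordinatewise partial order (inherited by $\Omega$), and whenever $\sigma,\tau\in\Omega$ satisfy $\sigma\le\tau$, for every $v\in V$ we have $\{\pi(\sigma_v^s)/\pi(\sigma_v^\bullet)\}_{s\in S}\preceq\{\pi(\tau_v^s)/\pi(\tau_v^\bullet)\}_{s\in S}$ as distributions on $S$. $\|\mu-\nu\|=\frac12\sum_{\sigma}|\mu(\sigma)-\nu(\sigma)|$ is total variation distance. *)

(* Defs.v *)
From HB Require Import structures.
From mathcomp Require Import all_boot all_order all_algebra.
From mathcomp Require Import classical_sets reals ereal esum.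

Set Implicit Arguments.
Unset Strict Implicit.
Unset Printing Implicit Defensive.

Import Order.TTheory GRing.Theory Num.Theory.
Local Open Scope ring_scope.

(* Distributions on Omega are functions on all of S^V; [sys_pi_out] is the
   convention that they are extended by 0 outside Omega. *)
Record system (R : realType) (S V : finType) := System {
  Omega : {set {ffun V -> S}};
  sys_pi : {ffun V -> S} -> R;
  sys_pi_gt0 : forall sigma, sigma \in Omega -> 0 < sys_pi sigma;
  sys_pi_out : forall sigma, sigma \notin Omega -> sys_pi sigma = 0;
  sys_pi_sum1 : \sum_(sigma in Omega) sys_pi sigma = 1
}.

Definition setspin (S V : finType) (sigma : {ffun V -> S}) (v : V) (s : S) :
  {ffun V -> S} := [ffun u => if u == v then s else sigma u].

Definition fiber (R : realType) (S V : finType) (X : system R S V)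
  (sigma : {ffun V -> S}) (v : V) : {set {ffun V -> S}} :=
  [set setspin sigma v s | s : S]%SET :&: Omega X.

Definition mass (R : realType) (T : finType) (mu : T -> R) (A : {set T}) : R :=
  \sum_(x in A) mu x.

(* The value is automatically 0 outside Omega, by [sys_pi_out]. *)
Definition update (R : realType) (S V : finType) (X : system R S V)
  (v : V) (mu : {ffun V -> S} -> R) : {ffun V -> S} -> R :=
  fun sigma => sys_pi X sigma / mass (sys_pi X) (fiber X sigma v)
               * mass mu (fiber X sigma v).

Definition point_mass (R : realType) (T : finType) (x : T) : T -> R :=
  fun y => (y == x)%:R.

Definition updates (R : realType) (S V : finType) (X : system R S V)
  (vs : seq V) (start : {ffun V -> S}) : {ffun V -> S} -> R :=
  foldl (fun mu v => update X v mu) (point_mass R start) vs.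

(* [stochdom le A nu mu] : nu is dominated by mu, as distributions on the
   finite poset whose carrier is A and whose order is le. *)
Definition stochdom (R : realType) (T : finType) (le : rel T) (A : {set T})
  (nu mu : T -> R) : Prop :=
  forall g : T -> R,
    {in A &, forall x y, le x y -> g x <= g y} ->
    \sum_(x in A) g x * nu x <= \sum_(x in A) g x * mu x.

Definition config_le (d : Order.disp_t) (S : finOrderType d) (V : finType) :
  rel {ffun V -> S} := fun sigma tau => [forall v, (sigma v <= tau v)%O].

Definition spin_law (R : realType) (S V : finType) (X : system R S V)
  (sigma : {ffun V -> S}) (v : V) : S -> R :=
  fun s => sys_pi X (setspin sigma v s) / mass (sys_pi X) (fiber X sigma v).

Definition monotone_system (R : realType) (d : Order.disp_t)
  (S : finOrderType d) (V : finType) (X : system R S V) : Prop :=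
  forall sigma tau, sigma \in Omega X -> tau \in Omega X ->
    config_le sigma tau ->
    forall v : V, stochdom (fun s t : S => (s <= t)%O) [set: S]%SET
                    (spin_law X sigma v) (spin_law X tau v).

Definition is_top (R : realType) (d : Order.disp_t)
  (S : finOrderType d) (V : finType) (X : system R S V)
  (top : {ffun V -> S}) : Prop :=
  top \in Omega X /\ forall sigma, sigma \in Omega X -> config_le sigma top.

Definition tv_dist (R : realType) (S V : finType) (X : system R S V)
  (mu nu : {ffun V -> S} -> R) : R :=
  2^-1 * \sum_(sigma in Omega X) `|mu sigma - nu sigma|.

(* A length m, sites v_1, ..., v_m, and a list of indices (counted from 0). *)
Definition scheme (V : finType) := {m : nat & (m.-tuple V * seq 'I_m)%type}.

Definition full_seq (V : finType) (x : scheme V) : seq V :=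
  val (tagged x).1.

Definition sub_indices (V : finType) (x : scheme V) : seq 'I_(tag x) :=
  (tagged x).2.

Definition sub_seq (V : finType) (x : scheme V) : seq V :=
  [seq tnth (tagged x).1 i | i <- sub_indices x].

Definition increasing_indices (V : finType) (x : scheme V) : bool :=
  sorted (fun i j : 'I_(tag x) => (i < j)%N) (sub_indices x).

(* A probability on the (countable) set of schemes whose index lists are
   increasing, given by its mass function. *)
Definition random_scheme (R : realType) (V : finType) (p : scheme V -> R) :
  Prop :=
  [/\ forall x, 0 <= p x,
      forall x, p x != 0 -> increasing_indices x
    & \esum_(x in [set: scheme V]%classic) (p x)%:E = 1%E].

Definition average (R : realType) (V : finType) (T : finType)
  (p : scheme V -> R) (mu : scheme V -> T -> R) : T -> R :=
  fun y => fine (\esum_(x in [set: scheme V]%classic) (p x * mu x y)%:E).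

(* Main.v *)
Require Import Defs.
From HB Require Import structures.
From mathcomp Require Import all_boot all_order all_algebra.
From mathcomp Require Import boolp classical_sets reals ereal esum.
From mathcomp Require Import ring lra.

(* The update at v averages the density mu/pi over the fibers at v (the sets
   sigma_v^bullet) with respect to pi. This averaging operator is self-adjoint
   in L^2(pi) and, by monotonicity of the system, preserves increasing
   functions. Hence updates preserve both stochastic domination and increasing
   densities, and, by Chebyshev's correlation inequality on the fibers, an
   update of a distribution with increasing density is dominated by that
   distribution. The point mass at the top has an increasing density, so
   deleting updates can only move the result up. *)

Set Implicit Arguments.
Unset Strict Implicit.
Unset Printing Implicit Defensive.

Import Order.TTheory GRing.Theory Num.Theory.
Local Open Scope ring_scope.

(** * The update as an averaging operator on fibers *)

Section Updates.
Variables (R : realType) (S V : finType) (X : system R S V).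
Implicit Types (sigma tau : {ffun V -> S}) (v : V).
Implicit Types mu nu g : {ffun V -> S} -> R.

Let pi := sys_pi X.

Lemma pi_ge0 sigma : 0 <= pi sigma.
Proof.
have [/sys_pi_gt0/ltW//|] := boolP (sigma \in Omega X).
by move=> /sys_pi_out; rewrite /pi => ->.
Qed.

Lemma mem_fiber sigma tau v :
  tau \in fiber X sigma v =
  (tau \in Omega X) && [forall u, (u != v) ==> (tau u == sigma u)].
Proof.
rewrite inE andbC; congr (_ && _); apply/imsetP/forallP.
  move=> [s _ ->] u; apply/implyP => uv.
  by rewrite ffunE (negbTE uv).
move=> H; exists (tau v) => //; apply/ffunP => u; rewrite ffunE.
by have [->//|uv] := eqVneq u v; apply/eqP; apply: (implyP (H u)).
Qed.

Lemma fiber_sub sigma v tau : tau \in fiber X sigma v -> tau \in Omega X.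
Proof. by rewrite mem_fiber => /andP[]. Qed.

Lemma fiber_refl sigma v : sigma \in Omega X -> sigma \in fiber X sigma v.
Proof.
by move=> h; rewrite mem_fiber h; apply/forallP => u; rewrite eqxx implybT.
Qed.

Lemma eq_fiber sigma tau v :
  tau \in fiber X sigma v -> fiber X tau v = fiber X sigma v.
Proof.
rewrite mem_fiber => /andP[_ /forallP h]; apply/setP => r.
rewrite !mem_fiber; congr (_ && _); apply: eq_forallb => u.
by have := h u; case: (u != v) => //= /eqP->.
Qed.

Lemma fiber_sym sigma tau v : sigma \in Omega X ->
  tau \in fiber X sigma v -> sigma \in fiber X tau v.
Proof. by move=> h /eq_fiber ->; exact: fiber_refl. Qed.

Lemma mass_fiber_gt0 sigma v :
  sigma \in Omega X -> 0 < mass pi (fiber X sigma v).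
Proof.
move=> h; rewrite /mass (bigD1 sigma) ?fiber_refl//=.
rewrite ltr_pwDl ?sys_pi_gt0// sumr_ge0// => t _; exact: pi_ge0.
Qed.

(** The conditional expectation of [g] under [pi], given all spins off [v]. *)
Definition fiber_mean v g : {ffun V -> S} -> R :=
  fun sigma => mass (fun tau => pi tau * g tau) (fiber X sigma v)
               / mass pi (fiber X sigma v).

Lemma update_fiber_mean v mu sigma :
  update X v mu sigma =
  pi sigma * fiber_mean v (fun tau => mu tau / pi tau) sigma.
Proof.
rewrite /update -/pi /fiber_mean mulrAC -mulrA; congr (_ * (_ / _)).
apply: eq_bigr => t /fiber_sub tO.
by rewrite mulrC divfK// gt_eqF// sys_pi_gt0.
Qed.

(** Lying in a common fiber is a symmetric relation on [Omega X]. *)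
Lemma exchange_fiber v (F : {ffun V -> S} -> {ffun V -> S} -> R) :
  \sum_(sigma in Omega X) \sum_(tau in fiber X sigma v) F sigma tau =
  \sum_(sigma in Omega X) \sum_(tau in fiber X sigma v) F tau sigma.
Proof.
rewrite (exchange_big_dep (mem (Omega X)))/=; last first.
  by move=> s t _; apply: fiber_sub.
apply: eq_bigr => t tO; apply: eq_bigl => s.
apply/andP/idP => [[sO h]|h]; first exact: fiber_sym.
by split; [exact: fiber_sub h|exact: fiber_sym].
Qed.

(** Self-adjointness: the normalizing mass is constant on a fiber, so exchanging the two variables
    moves the update onto the test function. *)
Lemma sum_update v mu g :
  \sum_(sigma in Omega X) g sigma * update X v mu sigma =
  \sum_(sigma in Omega X) fiber_mean v g sigma * mu sigma.
Proof.
pose F s t := g s * (pi s / mass pi (fiber X s v) * mu t).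
transitivity (\sum_(s in Omega X) \sum_(t in fiber X s v) F s t).
  by apply: eq_bigr => s _; rewrite /F -!mulr_sumr.
rewrite exchange_fiber; apply: eq_bigr => s sO.
rewrite /fiber_mean {1}/mass 2!mulr_suml; apply: eq_bigr => t tf.
by rewrite /F (eq_fiber tf) -/pi; ring.
Qed.

Lemma fiber_mean1 v sigma : sigma \in Omega X -> fiber_mean v (fun=> 1) sigma = 1.
Proof.
move=> sO; rewrite /fiber_mean /mass; under eq_bigr do rewrite mulr1.
by rewrite divff// gt_eqF// mass_fiber_gt0.
Qed.

Lemma mass_update v mu : mass (update X v mu) (Omega X) = mass mu (Omega X).
Proof.
have := sum_update v mu (fun=> 1); under eq_bigr do rewrite mul1r.
rewrite /mass => ->; apply: eq_bigr => s sO.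
by rewrite fiber_mean1// mul1r.
Qed.

Lemma update_ge0 v mu : (forall sigma, 0 <= mu sigma) ->
  forall sigma, 0 <= update X v mu sigma.
Proof.
move=> mu0 s; rewrite /update mulr_ge0 ?divr_ge0 ?sumr_ge0//; try exact: pi_ge0.
by move=> t _; exact: pi_ge0.
Qed.

Lemma updates_ge0 vs start sigma : 0 <= updates X vs start sigma.
Proof.
have : forall x, 0 <= point_mass R start x by move=> x; exact: ler0n.
rewrite /updates; elim: vs (point_mass R start) => [|v vs IH] m m0 /=; first exact: m0.
by apply: IH; exact: update_ge0.
Qed.

Lemma mass_updates vs start : start \in Omega X ->
  mass (updates X vs start) (Omega X) = 1.
Proof.
move=> sO; have : mass (point_mass R start) (Omega X) = 1.
  rewrite /mass (bigD1 start)//= /point_mass eqxx big1 ?addr0// => i /andP[_].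
  by move=> /negbTE->.
rewrite /updates; elim: vs (point_mass R start) => [//|v vs IH] m m1 /=.
by apply: IH; rewrite mass_update.
Qed.

Lemma updates_le1 vs start sigma : start \in Omega X -> sigma \in Omega X ->
  updates X vs start sigma <= 1.
Proof.
move=> h sO; rewrite -(mass_updates vs h) /mass (bigD1 sigma)//= lerDl sumr_ge0//.
by move=> t _; exact: updates_ge0.
Qed.

End Updates.

(** * Monotone systems: increasing densities and stochastic domination *)

Section Monotone.
Variables (R : realType) (d : Order.disp_t) (S : finOrderType d) (V : finType).
Variable X : system R S V.
Implicit Types (sigma tau : {ffun V -> S}) (v : V).
Implicit Types mu nu g : {ffun V -> S} -> R.

Let pi := sys_pi X.

Definition increasing_on_Omega g : Prop :=
  {in Omega X &, forall sigma tau, config_le sigma tau -> g sigma <= g tau}.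

Definition increasing_density mu : Prop :=
  increasing_on_Omega (fun sigma => mu sigma / sys_pi X sigma).

Lemma config_le_refl sigma : config_le sigma sigma.
Proof. exact/forallP. Qed.

Lemma config_le_trans tau sigma rho :
  config_le sigma tau -> config_le tau rho -> config_le sigma rho.
Proof.
move=> /forallP h /forallP k; apply/forallP => v; exact: le_trans (k v).
Qed.

Lemma config_le_setspin sigma tau v s t :
  config_le sigma tau -> (s <= t)%O -> config_le (setspin sigma v s) (setspin tau v t).
Proof.
by move=> /forallP h st; apply/forallP => u; rewrite !ffunE; case: ifP.
Qed.

(* The extension takes the supremum of g over the configurations of Omega
   below, or a lower bound of g if there are none. *)
Lemma extend_increasing g : increasing_on_Omega g ->
  exists2 G : {ffun V -> S} -> R,
    {in Omega X, G =1 g} & forall sigma tau, config_le sigma tau -> G sigma <= G tau.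
Proof.
move=> gI; pose c := - \sum_sigma `|g sigma|.
have cg t : c <= g t.
  rewrite /c lerNl (bigD1 t)//=.
  by rewrite (le_trans (ler_norm _))// normrN lerDl sumr_ge0.
exists (fun s => \big[Num.max/c]_(t in Omega X | config_le t s) g t).
  move=> s sO; apply/le_anti/andP; split.
    by apply: bigmax_le => // t /andP[tO ts]; exact: gI.
  by apply: le_bigmax_cond; rewrite sO config_le_refl.
move=> s t st; apply: sub_bigmax => r /andP[-> rs].
exact: config_le_trans st.
Qed.

(** Monotonicity of the system is stated for spin laws, so fiber means are rewritten as integrals
    against them. Spins leading out of [Omega X] contribute 0, whatever [g] is there. *)
Lemma fiber_mean_spin_law v g sigma : sigma \in Omega X ->
  fiber_mean X v g sigma = \sum_s g (setspin sigma v s) * spin_law X sigma v s.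
Proof.
move=> sO; rewrite /fiber_mean {1}/mass mulr_suml.
transitivity (\sum_(t in [set setspin sigma v s | s : S]%SET)
    sys_pi X t * g t / mass (sys_pi X) (fiber X sigma v)).
  rewrite [RHS](big_setID (Omega X))/= [X in _ + X]big1 ?addr0// => t.
  by rewrite inE => /andP[/sys_pi_out-> _]; rewrite !mul0r.
rewrite big_imset/=; last first.
  by move=> s t _ _ /ffunP/(_ v); rewrite !ffunE eqxx.
by apply: eq_big => [s|s _]; rewrite ?inE// /spin_law mulrA (mulrC (g _)).
Qed.

(** Members of a fiber differ only at [v], and [S] is totally ordered. *)
Lemma fiber_comparable sigma v tau :
  tau \in fiber X sigma v -> config_le sigma tau \/ config_le tau sigma.
Proof.
rewrite mem_fiber => /andP[_ /forallP h].
have eqst u : u != v -> tau u = sigma u by move=> uv; apply/eqP/(implyP (h u)).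
have [vst|vts] := leP (sigma v) (tau v); [left|right]; apply/forallP => u;
  have [->//|/eqst->//] := eqVneq u v; exact: ltW.
Qed.

(* Chebyshev's correlation inequality on each fiber, which is a chain. *)
Lemma update_stochdom v mu :
  increasing_density mu -> stochdom (@config_le d S V) (Omega X) (update X v mu) mu.
Proof.
move=> muI g gI; pose f s := mu s / pi s.
(* The weight of drawing [s] from [pi] and then [t] by an update at [v]; it is symmetric within a
   fiber. *)
pose K s t := pi s * pi t / mass pi (fiber X s v).
pose A s t := K s t * (g s * f s - g s * f t).
have Asum : \sum_(s in Omega X) g s * mu s - \sum_(s in Omega X) g s * update X v mu s
    = \sum_(s in Omega X) \sum_(t in fiber X s v) A s t.
  rewrite -sumrB; apply: eq_bigr => s sO.
  have m0 := lt0r_neq0 (mass_fiber_gt0 v sO); have p0 := lt0r_neq0 (sys_pi_gt0 sO).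
  rewrite /A; under [RHS]eq_bigr do rewrite mulrBr.
  rewrite sumrB; congr (_ - _).
    rewrite -mulr_suml /K -mulr_suml -mulr_sumr -/(mass pi _) mulfK//.
    by rewrite /f -/pi mulrCA; congr (_ * _); rewrite mulrC divfK.
  rewrite update_fiber_mean /fiber_mean {1}/mass 2!(mulr_suml, mulr_sumr).
  rewrite mulr_sumr; apply: eq_bigr => t _.
  by rewrite /K /f -/pi; ring.
rewrite -subr_ge0 Asum.
(* Adding the same sum with [s] and [t] exchanged gives the summand
   [K s t * ((g s - g t) * (f s - f t))], whose two differences have the same sign on a chain. *)
suff : 0 <= (\sum_(s in Omega X) \sum_(t in fiber X s v) A s t) *+ 2.
  by rewrite pmulrn_lge0.
rewrite mulr2n {2}exchange_fiber -big_split/= sumr_ge0// => s sO.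
rewrite -big_split/= sumr_ge0// => t tf.
have tO := fiber_sub tf.
have -> : A s t + A t s = K s t * ((g s - g t) * (f s - f t)).
  by rewrite /A /K (eq_fiber tf); ring.
rewrite mulr_ge0//.
  by rewrite divr_ge0 ?mulr_ge0 ?pi_ge0// ltW// mass_fiber_gt0.
have [st|ts] := fiber_comparable tf.
  by rewrite mulr_le0// subr_le0; [exact: gI|exact: muI].
by rewrite mulr_ge0// subr_ge0; [exact: gI|exact: muI].
Qed.

(* With h the sign of mu - pi, which is increasing,
   \sum |mu - pi| = \sum h (mu - pi) <= \sum h (nu - pi) <= \sum |nu - pi|. *)
Lemma tv_dist_le mu nu : increasing_density mu ->
  stochdom (@config_le d S V) (Omega X) mu nu ->
  tv_dist X mu pi <= tv_dist X nu pi.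
Proof.
move=> muI munu; rewrite /tv_dist ler_pM2l ?invr_gt0//.
pose h s : R := if pi s <= mu s then 1 else -1.
have hI : increasing_on_Omega h.
  move=> s t sO tO st; rewrite /h; case: ifP => [pm|_]; last by case: ifP; lra.
  (* [pi s <= mu s] says that the density at [s] is at least 1, which passes to every larger
     configuration. *)
  rewrite ifT// -[pi t]mul1r -ler_pdivlMr ?sys_pi_gt0//.
  apply: le_trans (muI _ _ sO tO st).
  by rewrite ler_pdivlMr ?sys_pi_gt0// mul1r.
rewrite (eq_bigr (fun s => h s * mu s - h s * pi s)); last first.
  move=> s _; rewrite -mulrBr /h; have [le_pm|lt_mp] := leP (pi s) (mu s).
    by rewrite ger0_norm ?subr_ge0// mul1r.
  by rewrite ltr0_norm ?subr_lt0// mulN1r.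
rewrite sumrB; apply: (@le_trans _ _ (\sum_(s in Omega X) h s * (nu s - pi s))).
  under [leRHS]eq_bigr do rewrite mulrBr.
  by rewrite sumrB lerD2r; exact: munu.
apply: ler_sum => s _; rewrite (le_trans (ler_norm _))// normrM /h.
by case: ifP; rewrite ?normrN normr1 mul1r.
Qed.

Hypothesis Xmono : monotone_system X.

(** First the spin law at [s] is replaced by that at [t], by monotonicity of the system; then
    [setspin s v a] is replaced by [setspin t v a] pointwise. The intermediate sum may evaluate the
    function outside [Omega X], so [g] is first extended. *)
Lemma fiber_mean_increasing v g :
  increasing_on_Omega g -> increasing_on_Omega (fiber_mean X v g).
Proof.
move=> /extend_increasing[G Gg GI] s t sO tO st.
have E r : fiber_mean X v g r = fiber_mean X v G r.
  by congr (_ / _); apply: eq_bigr => x /fiber_sub xO; rewrite Gg.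
rewrite !{}E !fiber_mean_spin_law//.
apply: (@le_trans _ _ (\sum_a G (setspin s v a) * spin_law X t v a)).
  have setTE F : \sum_a F a = \sum_(a in [set: S]%SET) F a :> R.
    by apply: eq_bigl => a; rewrite inE.
  rewrite !setTE.
  apply: (Xmono sO tO st v (g := fun a => G (setspin s v a))) => a b _ _ ab.
  by apply: GI; apply: config_le_setspin => //; exact: config_le_refl.
apply: ler_sum => a _; apply: ler_wpM2r.
  by rewrite divr_ge0 ?pi_ge0// ltW// mass_fiber_gt0.
by apply: GI; exact: config_le_setspin.
Qed.

Lemma update_increasing_density v mu :
  increasing_density mu -> increasing_density (update X v mu).
Proof.
move=> muI s t sO tO st; rewrite !update_fiber_mean.
rewrite ![sys_pi X _ * _]mulrC !mulfK ?gt_eqF ?sys_pi_gt0//.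
exact: fiber_mean_increasing.
Qed.

Lemma update_homo v mu nu :
  stochdom (@config_le d S V) (Omega X) mu nu ->
  stochdom (@config_le d S V) (Omega X) (update X v mu) (update X v nu).
Proof.
by move=> munu g gI; rewrite !sum_update; apply: munu; exact: fiber_mean_increasing.
Qed.

Lemma foldl_update_increasing_density vs mu : increasing_density mu ->
  increasing_density (foldl (fun m v => update X v m) mu vs).
Proof.
elim: vs mu => [//|v vs IH] mu muI /=.
by apply: IH; exact: update_increasing_density.
Qed.

(** A kept update acts on both sides and preserves domination; a deleted one acts on [mu] alone and
    lowers it, its density being increasing. Two starting distributions are carried along because
    they differ after a deletion. *)
Lemma censoring_stochdom vs ws mu nu : subseq ws vs -> increasing_density mu ->
  stochdom (@config_le d S V) (Omega X) mu nu ->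
  stochdom (@config_le d S V) (Omega X)
    (foldl (fun m v => update X v m) mu vs) (foldl (fun m v => update X v m) nu ws).
Proof.
elim: vs ws mu nu => [|v vs IH] ws mu nu; first by move=> /eqP->.
case: ws => [|w ws] sub muI munu.
  apply: (IH [::]); rewrite ?sub0seq//; first exact: update_increasing_density.
  by move=> g gI; apply: le_trans (munu g gI); exact: update_stochdom.
move: sub => /=; case: eqP => [->|_] sub.
  by apply: IH => //; [exact: update_increasing_density|exact: update_homo].
apply: (IH (w :: ws)) => //; first exact: update_increasing_density.
by move=> g gI; apply: le_trans (munu g gI); exact: update_stochdom.
Qed.

Variable top : {ffun V -> S}.
Hypothesis Xtop : is_top X top.

(** The density vanishes off [top], and nothing in [Omega X] lies strictly above [top]. *)
Lemma point_mass_top_increasing_density : increasing_density (point_mass R top).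
Proof.
move=> s t sO tO st; rewrite /point_mass.
have [E|_] := eqVneq s top; last by rewrite mul0r divr_ge0// pi_ge0.
suff -> : t = s by rewrite E eqxx.
apply/ffunP => u; apply/le_anti; rewrite (forallP st u) andbT E.
exact: (forallP (Xtop.2 _ tO) u).
Qed.

Lemma updates_increasing_density vs : increasing_density (updates X vs top).
Proof. exact/foldl_update_increasing_density/point_mass_top_increasing_density. Qed.

Lemma updates_subseq_stochdom vs ws : subseq ws vs ->
  stochdom (@config_le d S V) (Omega X) (updates X vs top) (updates X ws top).
Proof.
move=> sub; apply: censoring_stochdom => //.
exact: point_mass_top_increasing_density.
Qed.

End Monotone.

(** * Index lists and infinite sums *)

Lemma sub_seq_subseq (V : finType) (x : scheme V) :
  increasing_indices x -> subseq (sub_seq x) (full_seq x).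
Proof.
case: x => m [t js]; rewrite /increasing_indices /sub_seq /full_seq /sub_indices /=.
move=> js_sorted.
(* A strictly increasing list is determined by its members, so [js] is a filtering of all indices,
   hence a subsequence of them. *)
have -> : js = [seq i <- enum 'I_m | i \in js].
  apply: (irr_sorted_eq (leT := fun i j : 'I_m => (i < j)%N)) => //.
  - by move=> ? ? ?; exact: ltn_trans.
  - by move=> ?; exact: ltnn.
  - apply: sorted_filter; first by move=> ? ? ?; exact: ltn_trans.
    by rewrite -(@sorted_map _ _ val ltn) val_enum_ord iota_ltn_sorted.
  - by move=> i; rewrite mem_filter mem_enum andbT.
by rewrite -[X in subseq _ X](map_tnth_enum t) map_subseq// filter_subseq.
Qed.

(** The scalar passes through the supremum of finite partial sums that defines [esum]. *)
Lemma esumZl (R : realType) (T : choiceType) (I : set T) (c : R)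
  (a : T -> \bar R) : 0 <= c -> (forall x, (0 <= a x)%E) ->
  (\esum_(x in I) (c%:E * a x) = c%:E * \esum_(x in I) a x)%E.
Proof.
move=> c0 a0; rewrite /esum -ereal_supZl//; last first.
  apply/set0P; eexists; exists set0; first exact: fsets_set0.
  by [].
congr ereal_sup; apply/seteqP; split => [_ [F IF <-]|_ [_ [F IF <-] <-]] /=.
  by exists (\sum_(x \in F) a x)%E; [exists F|rewrite ge0_mule_fsumr].
by exists F; rewrite ?ge0_mule_fsumr.
Qed.

(** * Averages over a random scheme *)

Section RandomScheme.
Variables (R : realType) (V T : finType) (p : scheme V -> R).
Hypothesis p_random : random_scheme p.

Definition expect (a : scheme V -> R) : R :=
  fine (\esum_(x in [set: scheme V]%classic) (p x * a x)%:E).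

Lemma random_scheme_ge0 x : 0 <= p x. Proof. by case: p_random. Qed.

(** The weights sum to 1, so the sum is at most [c]. Finiteness matters because [fine] sends
    infinite values to 0. *)
Lemma esum_bounded_fin_num (a : scheme V -> R) c :
  (forall x, 0 <= a x <= c) ->
  \esum_(x in [set: scheme V]%classic) (p x * a x)%:E \is a fin_num.
Proof.
move=> ac; have c0 : 0 <= c.
  (* The empty scheme witnesses that [c] bounds some nonnegative value. *)
  by have /andP[/le_trans h /h] := ac (existT _ 0%N ([tuple], [::])).
rewrite ge0_fin_numE; last first.
  by apply: esum_ge0 => x _; rewrite lee_fin mulr_ge0 ?random_scheme_ge0//; case/andP: (ac x).
have [_ _ p1] := p_random.
apply: (@le_lt_trans _ _ c%:E); last exact: ltry.
rewrite -[leRHS]mule1 -p1 -esumZl//; last by move=> x; rewrite lee_fin random_scheme_ge0.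
apply: le_esum => x _; rewrite -EFinM lee_fin mulrC ler_wpM2r ?random_scheme_ge0//.
by case/andP: (ac x).
Qed.

(** The comparison is asked only where [p] is nonzero, since only there are the index lists known to
    be increasing. *)
Lemma le_expect (a b : scheme V -> R) c d :
  (forall x, 0 <= a x <= c) -> (forall x, 0 <= b x <= d) ->
  (forall x, p x != 0 -> a x <= b x) -> expect a <= expect b.
Proof.
move=> ac bd ab; apply: fine_le; try exact: esum_bounded_fin_num.
apply: le_esum => x _; rewrite lee_fin.
have [->|/ab h] := eqVneq (p x) 0; first by rewrite !mul0r.
by rewrite ler_wpM2l ?random_scheme_ge0.
Qed.

Lemma expect1 : expect (fun=> 1) = 1.
Proof.
have [_ _ p1] := p_random.
by rewrite /expect; under eq_esum do rewrite mulr1; rewrite p1.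
Qed.

Lemma expect_sum (A : {set T}) (g : T -> R) (a : T -> scheme V -> R) c :
  (forall i, 0 <= g i) -> (forall i x, i \in A -> 0 <= a i x <= c) ->
  expect (fun x => \sum_(i in A) g i * a i x) = \sum_(i in A) g i * expect (a i).
Proof.
move=> g0 ac; have pa0 i x : i \in A -> 0 <= p x * a i x.
  by move=> iA; rewrite mulr_ge0 ?random_scheme_ge0//; case/andP: (ac i x iA).
rewrite /expect (eq_esum (b := fun x =>
  \sum_(i in A) ((g i)%:E * (p x * a i x)%:E))%E); last first.
  move=> x _; rewrite mulr_sumr -sumEFin; apply: eq_bigr => i _.
  by rewrite mulrCA EFinM.
rewrite esum_sum; last by move=> x i _ iA; rewrite -EFinM lee_fin mulr_ge0// pa0.
transitivity (fine (\sum_(i in A) (g i * expect (a i))%:E)%E).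
  congr fine; apply: eq_bigr => i iA; rewrite (EFinM (g i)) /expect fineK; last first.
    by apply: (@esum_bounded_fin_num _ c) => x; exact: ac.
  by rewrite esumZl// => x; rewrite lee_fin pa0.
by rewrite sumEFin.
Qed.

Section AverageOfDistributions.
Variables (A : {set T}) (mu : scheme V -> T -> R).
Hypothesis mu_ge0 : forall x i, i \in A -> 0 <= mu x i.
Hypothesis mu_mass1 : forall x, mass (mu x) A = 1.

Lemma distribution_bounded i x : i \in A -> 0 <= mu x i <= 1.
Proof.
move=> iA; rewrite mu_ge0//= -(mu_mass1 x) /mass (bigD1 i)//= lerDl sumr_ge0//.
by move=> j /andP[jA _]; exact: mu_ge0.
Qed.

Lemma sum_average (g : T -> R) : (forall i, 0 <= g i) ->
  \sum_(i in A) g i * average p mu i = expect (fun x => \sum_(i in A) g i * mu x i).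
Proof.
move=> g0; rewrite (@expect_sum A g (fun i x => mu x i) 1)// => i x.
exact: distribution_bounded.
Qed.

Lemma mass_average : mass (average p mu) A = 1.
Proof.
transitivity (\sum_(i in A) 1 * average p mu i).
  by apply: eq_bigr => i _; rewrite mul1r.
rewrite (@sum_average (fun=> 1))// -[RHS]expect1; congr expect; apply: funext => x /=.
by under eq_bigr do rewrite mul1r; exact: mu_mass1.
Qed.

Lemma integral_bounded (g : T -> R) x : (forall i, 0 <= g i) ->
  0 <= \sum_(i in A) g i * mu x i <= \sum_(i in A) g i.
Proof.
move=> g0; apply/andP; split.
  by apply: sumr_ge0 => i iA; rewrite mulr_ge0// mu_ge0.
apply: ler_sum => i iA; have /andP[_ h] := distribution_bounded x iA.
by rewrite ler_piMr.
Qed.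

End AverageOfDistributions.

(* Shifting g by a constant makes it nonnegative, so that sums over schemes may
   be exchanged with sums over T; equality of the masses cancels the shift. *)
Lemma stochdom_average (le : rel T) (A : {set T}) (mu nu : scheme V -> T -> R) :
  (forall x i, i \in A -> 0 <= mu x i) -> (forall x, mass (mu x) A = 1) ->
  (forall x i, i \in A -> 0 <= nu x i) -> (forall x, mass (nu x) A = 1) ->
  (forall x, p x != 0 -> stochdom le A (mu x) (nu x)) ->
  stochdom le A (average p mu) (average p nu).
Proof.
move=> mu0 mu1 nu0 nu1 munu g gI.
pose c := \sum_i `|g i|; pose h i := g i + c.
have h0 i : 0 <= h i.
  rewrite /h /c (bigD1 i)//= addrA addr_ge0 ?sumr_ge0//.
  by rewrite -lerBlDl sub0r -normrN ler_norm.
have shift m : mass m A = 1 ->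
    \sum_(i in A) g i * m i = \sum_(i in A) h i * m i - c.
  move=> m1; rewrite -[X in _ - X]mulr1 -[X in _ * X]m1 mulr_sumr -sumrB.
  by apply: eq_bigr => i _; rewrite /h mulrDl addrK.
rewrite !shift ?mass_average// lerD2r !sum_average//.
apply: le_expect => [x|x|x /munu]; [exact: integral_bounded|exact: integral_bounded|].
apply=> i j iA jA ij; rewrite lerD2r; exact: gI.
Qed.

End RandomScheme.

(** For fixed [s] and [t] the inequality between densities is linear in the distribution, so it
    survives averaging. This lets [tv_dist_le] apply to the averaged distribution itself. *)
Lemma increasing_density_average (R : realType) (d : Order.disp_t)
  (S : finOrderType d) (V : finType) (X : system R S V) (p : scheme V -> R)
  (mu : scheme V -> {ffun V -> S} -> R) : random_scheme p ->
  (forall x s, s \in Omega X -> 0 <= mu x s) ->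
  (forall x, mass (mu x) (Omega X) = 1) ->
  (forall x, increasing_density X (mu x)) -> increasing_density X (average p mu).
Proof.
move=> p_random mu0 mu1 muI s t sO tO st.
have weighted r : r \in Omega X -> average p mu r / sys_pi X r =
    expect p (fun x => (sys_pi X r)^-1 * mu x r).
  move=> rO; have := @expect_sum _ _ _ p p_random [set r]%SET
    (fun r => (sys_pi X r)^-1) (fun r x => mu x r) 1.
  rewrite big_set1 mulrC => <-.
  - by congr expect; apply: funext => x; rewrite big_set1.
  - by move=> i; rewrite invr_ge0; exact: pi_ge0.
  - by move=> i x; rewrite inE => /eqP->; exact: distribution_bounded rO.
have bound r x : r \in Omega X ->
    0 <= (sys_pi X r)^-1 * mu x r <= (sys_pi X r)^-1.
  move=> rO; have /andP[m0 m1] := distribution_bounded mu0 mu1 x rO.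
  by rewrite mulr_ge0 ?ler_piMr ?invr_ge0 ?pi_ge0.
rewrite !weighted//; apply: le_expect => //.
- by move=> x; exact: bound.
- by move=> x; exact: bound.
by move=> x _; rewrite ![_^-1 * _]mulrC; exact: muI.
Qed.

Theorem theorem1p1 (R : realType) (d : Order.disp_t) (S : finOrderType d)
  (V : finType) (X : system R S V) (top : {ffun V -> S})
  (Xmono : monotone_system X) (Xtop : is_top X top) :
  (forall x : scheme V, increasing_indices x ->
     let mu := updates X (full_seq x) top in
     let nu := updates X (sub_seq x) top in
     stochdom (@config_le d S V) (Omega X) mu nu /\
     tv_dist X mu (sys_pi X) <= tv_dist X nu (sys_pi X))
  /\
  (forall p : scheme V -> R, random_scheme p ->
     let mu := average p (fun x => updates X (full_seq x) top) in
     let nu := average p (fun x => updates X (sub_seq x) top) in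
     stochdom (@config_le d S V) (Omega X) mu nu /\
     tv_dist X mu (sys_pi X) <= tv_dist X nu (sys_pi X)).
Proof.
split=> [x xI mu nu|p p_random mu nu].
  have munu : stochdom (@config_le d S V) (Omega X) mu nu.
    exact/updates_subseq_stochdom/sub_seq_subseq.
  by split=> //; apply: tv_dist_le munu; exact: updates_increasing_density.
have topO := Xtop.1.
have munu : stochdom (@config_le d S V) (Omega X) mu nu.
  apply: stochdom_average => //; try by move=> *; exact: updates_ge0.
  - by move=> x; exact: mass_updates.
  - by move=> x; exact: mass_updates.
  have [_ incr _] := p_random.
  by move=> x /incr xI; exact/updates_subseq_stochdom/sub_seq_subseq.
split=> //; apply: tv_dist_le munu; apply: increasing_density_average => //.
- by move=> *; exact: updates_ge0.
- by move=> x; exact: mass_updates.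
- by move=> x; exact: updates_increasing_density.
Qed.
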